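(* Let $\mathbb{F}$ be a field, let $T$ be a tree, and let $M\in\mathcal{M}_{\mathbb{F},0}(T)$. Then $R^M\,\mathrm{Rank}(A(T))=\mathrm{Rank}(M)$; that is, $\{R^M\vec{x}:\vec{x}\in\mathrm{Rank}(A(T))\}=\mathrm{Rank}(M)$, where $R^M$ is the rank-normalization of $M$.
   Context: All graphs are finite, undirected, without loops or multiple edges. $\mathbb{F}$ is an arbitrary field. For a graph $G$, $\mathcal{M}_{\mathbb{F},0}(G)$ is the set of all (not necessarily symmetric) matrices $M$ over $\mathbb{F}$ with rows and columns indexed by $V(G)$, with all diagonal entries zero, and such that for distinct $u,w\in V(G)$ the entry $M_{u,w}$ is nonzero if and only if $\{u,w\}\in E(G)$. $A(G)$ is the adjacency matrix of $G$, viewed as a $(0,1)$-matrix over $\mathbb{F}$. $\mathrm{Rank}(M)$ denotes the subspace of $\mathbb{F}^{V(G)}$ spanned by the columns of $M$ (a subspace, not its dimension). The null support $\mathrm{Supp}(M)$ is the set of vertices $w$ such that some $\vec{x}$ with $M\vec{x}=0$ has $\vec{x}_w\neq 0$. For a tree $T$ and vertices $v,w$, let $\pi(v,w)$ be the second vertex of the path from $v$ to $w$ in $T$, where $v$ is the first vertex of the path. For $v\in V(T)$ the $v$-normalization of $M$ is the non-singular diagonal matrix $C^{(M,v)}$, indexed by $V(T)$, with $C^{(M,v)}_{w,w}=M_{v,\pi(v,w)}$ for $w\neq v$, and $C^{(M,v)}_{v,v}=1$. The rank-normalization of $M$ is $R^M=\prod_{v\in V(T)\setminus\mathrm{Sup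p}(M)}C^{(M,v)}$.
   Formalization: In the normalization, M_{v,π(v,w)} is read as the entry in column v and row π(v,w); with the usual row-first reading the claim fails for nonsymmetric M (e.g. a star with two leaves). For symmetric M the readings agree. *)

(* Defs.v *)
(* MathComp, with [boolp] only for the decidability of the null support. *)
From mathcomp Require Import all_boot all_algebra.
From mathcomp Require Import boolp.

Set Implicit Arguments.
Unset Strict Implicit.
Unset Printing Implicit Defensive.

Import GRing.Theory.
Local Open Scope ring_scope.

Definition simple_graph (V : finType) (e : rel V) : Prop :=
  symmetric e /\ irreflexive e.

(* A duplicate-free closed walk [:: x; y] merely goes back and forth along an
   edge, so cycles of the graph are those of length at least 3. *)
Definition acyclic (V : finType) (e : rel V) : Prop :=
  forall c : seq V, ucycle e c -> (size c <= 2)%N.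

Definition connected (V : finType) (e : rel V) : Prop :=
  (0 < #|V|)%N /\ forall u w : V, connect e u w.

Definition tree (V : finType) (e : rel V) : Prop :=
  [/\ simple_graph e, connected e & acyclic e].

Definition path_from_to (V : finType) (e : rel V) (v w : V) (p : seq V) : bool :=
  [&& path e v p, uniq (v :: p) & last v p == w].

(* The second vertex of the path from v to w.  The size bound on p excludes no
   path, since v :: p has no repetition; in a tree there is exactly one
   candidate p.  The default v is returned if w = v or if there is no path. *)
Definition second_vertex (V : finType) (e : rel V) (v w : V) : V :=
  if [pick p : #|V|.-bseq V | path_from_to e v w p] is Some p
  then head v p else v.

(* Matrices and vectors indexed by V are indexed by 'I_#|V|, the vertex w
   corresponding to the index enum_rank w. *)

(* Index convention: M_{u,w} is the entry in COLUMN u and ROW w, so that column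
   v of M carries the scalars M_{v,-}.  The order of the indices is immaterial
   everywhere except in [normalization].  There, with row-first indices, the
   image of the column space of A(T) would be the row space of M and not its
   column space: for the star on {c, a, b} with centre c,
     the column space of A is spanned by 1_c and 1_a + 1_b,
     that of M by 1_c and (row a, col c) 1_a + (row b, col c) 1_b,
   and the rank-normalization must use the entries of column c. *)
Definition entry (F : fieldType) (V : finType) (M : 'M[F]_#|V|) (u w : V) : F :=
  M (enum_rank w) (enum_rank u).

Definition adjacency (F : fieldType) (V : finType) (e : rel V) : 'M[F]_#|V| :=
  \matrix_(i, j) (e (enum_val i) (enum_val j))%:R.

(* The set M_{F,0}(G), G having edge relation e. *)
Definition graph_matrix0 (F : fieldType) (V : finType) (e : rel V)
    (M : 'M[F]_#|V|) : Prop :=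
  (forall u : V, entry M u u = 0) /\
  (forall u w : V, u != w -> (entry M u w != 0) = e u w).

Definition colspace (F : fieldType) (V : finType) (M : 'M[F]_#|V|) :
    {vspace 'cV[F]_#|V|} :=
  <<[seq col j M | j : 'I_#|V|]>>%VS.

Definition null_support (F : fieldType) (V : finType) (M : 'M[F]_#|V|) : {set V} :=
  [set w | `[< exists x : 'cV[F]_#|V|, M *m x = 0 /\ x (enum_rank w) 0 <> 0 >]].

Definition normalization (F : fieldType) (V : finType) (e : rel V)
    (M : 'M[F]_#|V|) (v : V) : 'M[F]_#|V| :=
  diag_mx (\row_i (let w := enum_val i in
                   if w == v then 1 else entry M v (second_vertex e v w))).

Definition rank_normalization (F : fieldType) (V : finType) (e : rel V)
    (M : 'M[F]_#|V|) : 'M[F]_#|V| :=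
  \prod_(v | v \notin null_support M) normalization e M v.

(* Main.v *)
(** Over a tree, [M = diag(a) A(T) diag(b)] with nowhere zero [a] and [b], so
    [M], its transpose and [A(T)] have the same null support [S].  By duality
    both column spaces contain the unit vectors of all vertices outside [S].
    Moreover [S] is independent, so modulo these unit vectors the columns
    indexed by [S] vanish, and a column of a vertex [u] outside [S] is sent by
    the rank-normalization to a nonzero multiple of the column [u] of [M]: for
    [v] outside [S], [v <> u], the factors [M_{v,pi(v,w)}] agree for all
    neighbours [w] of [u] in [S]. *)
Require Import Defs.
From mathcomp Require Import all_boot all_algebra.
From mathcomp Require Import boolp.

Set Implicit Arguments.
Unset Strict Implicit.
Unset Printing Implicit Defensive.

Import GRing.Theory.
Local Open Scope ring_scope.

Definition tree_path (V : finType) (e : rel V) (v w : V) : seq V :=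
  if [pick p : #|V|.-bseq V | path_from_to e v w p] is Some p
  then p else [::].

Lemma second_vertexE (V : finType) (e : rel V) (v w : V) :
  second_vertex e v w = head v (tree_path e v w).
Proof. by rewrite /second_vertex /tree_path; case: pickP. Qed.

Section TreePaths.

Variables (V : finType) (e : rel V).
Hypothesis e_tree : tree e.

Let e_sym : symmetric e. Proof. by case: e_tree => [[]]. Qed.
Let e_irr : irreflexive e. Proof. by case: e_tree => [[]]. Qed.

Lemma path_from_to_step v u w p : path_from_to e v u p -> e u w ->
  path_from_to e v w (rcons p w) \/
  exists2 q, p = rcons q u & path_from_to e v w q.
Proof.
move=> /and3P[ep Up /eqP lp] euw.
case w_in: (w \in v :: p); last first.
  left; apply/and3P; split; last by rewrite last_rcons.
    by rewrite rcons_path ep lp.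
  by rewrite -rcons_cons rcons_uniq w_in.
right; case/splitPl: w_in ep Up lp => p1 p2 lp1.
rewrite cat_path last_cat lp1 -cat_cons => /andP[ep1 ep2] U12 lp2.
have [_ _ /(_ (w :: p2)) acyc] := e_tree.
have Uw2 : uniq (w :: p2).
  move: U12; rewrite (lastI v p1) cat_rcons lp1 cat_uniq.
  by case/and3P.
have {}acyc : (size (w :: p2) <= 2)%N.
  by apply: acyc; rewrite /ucycle Uw2 /= rcons_path ep2 lp2 euw.
case: p2 lp2 acyc {ep2 Uw2} U12 => [/= wu|z [|//] /= zu] _.
  by move: euw; rewrite wu e_irr.
rewrite zu => U12; exists p1; first by rewrite cats1.
apply/and3P; split; rewrite ?lp1 //.
by have: uniq ((v :: p1) ++ [:: u]) by []; rewrite cat_uniq => /andP[].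
Qed.

Lemma path_from_to_uniq v w p q :
  path_from_to e v w p -> path_from_to e v w q -> p = q.
Proof.
elim/last_ind: p w q => [|p z IHp] w q.
  case/and3P=> _ _ /eqP <- /and3P[_ + /eqP].
  case: q => // x q /= /andP[vNq _] lq.
  by rewrite -{1}lq mem_last in vNq.
move=> /and3P[]; rewrite rcons_path last_rcons -rcons_cons rcons_uniq.
move=> /andP[ep ez] /andP[zNp Up] /eqP zw; rewrite {z}zw in ez zNp *.
move=> vwq; have vup : path_from_to e v (last v p) p by apply/and3P; split.
have ewu : e w (last v p) by rewrite e_sym.
have [vuq|[q' -> vuq']] := path_from_to_step vwq ewu.
  have pE := IHp _ _ vup vuq.
  case/and3P: vwq => _ _ /eqP lq.
  by case/negP: zNp; rewrite pE -rcons_cons mem_rcons inE -lq mem_last orbT.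
by rewrite (IHp _ _ vup vuq').
Qed.

Lemma tree_pathP v w : path_from_to e v w (tree_path e v w).
Proof.
rewrite /tree_path; case: pickP => // no_path.
have [_ [_ /(_ v w)/connectP[p0 ep0 wE]] _] := e_tree; rewrite wE in no_path *.
case/shortenP: ep0 no_path {wE} => p ep Up _ no_path.
have szp : (size p <= #|V|)%N.
  by rewrite -(card_uniqP (subseq_uniq (subseq_cons p v) Up)) max_card.
have := no_path (Bseq szp); rewrite /path_from_to /= ep eqxx andbT.
by move: Up => /= ->.
Qed.

Lemma tree_path_eq v w p : path_from_to e v w p -> tree_path e v w = p.
Proof. exact: path_from_to_uniq (tree_pathP v w). Qed.

Lemma tree_pathxx v : tree_path e v v = [::].
Proof. by apply: tree_path_eq; rewrite /path_from_to /= eqxx. Qed.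

Lemma tree_path_nil v w : (tree_path e v w == [::]) = (v == w).
Proof.
apply/eqP/eqP => [|->]; last exact: tree_pathxx.
by move=> p0; have /and3P[_ _ /eqP] := tree_pathP v w; rewrite p0.
Qed.

Lemma tree_path_edge v u w : e u w ->
  tree_path e v w = rcons (tree_path e v u) w \/
  tree_path e v u = rcons (tree_path e v w) u.
Proof.
move=> /(path_from_to_step (tree_pathP v u))[/tree_path_eq|[q -> /tree_path_eq ->]].
  by left.
by right.
Qed.

Lemma odd_tree_path_edge v u w : e u w ->
  odd (size (tree_path e v w)) = ~~ odd (size (tree_path e v u)).
Proof.
by move=> /(tree_path_edge v)[] ->; rewrite size_rcons /= ?negbK.
Qed.

Lemma second_vertex_edge v u w : e u w -> u != v -> w != v ->
  second_vertex e v w = second_vertex e v u.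
Proof.
have head_rcons z y p : p != [::] -> head z (rcons p y) = head z p by case: p.
move=> euw uv wv; rewrite !second_vertexE.
by case: (tree_path_edge v euw) => ->; rewrite head_rcons // tree_path_nil eq_sym.
Qed.

Lemma second_vertex_nbr v w : e v w -> second_vertex e v w = w.
Proof.
move=> evw; rewrite second_vertexE.
have [->|] := tree_path_edge v evw; rewrite tree_pathxx //.
by case: (tree_path e v w).
Qed.

Lemma second_vertex_adj v w : w != v -> e v (second_vertex e v w).
Proof.
move=> wv; rewrite second_vertexE; have /and3P[] := tree_pathP v w.
have := tree_path_nil v w; rewrite eq_sym [v == w]eq_sym (negPf wv).
by case: (tree_path e v w) => //= x p _ /andP[].
Qed.

Lemma tree_recursion (X : Type) (P : X -> Prop) (step : V -> V -> X -> X) x0 r :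
  P x0 -> (forall u w x, e u w -> P x -> P (step u w x)) ->
  exists f : V -> X, (forall w, P (f w)) /\
    forall u w, tree_path e r w = rcons (tree_path e r u) w ->
      f w = step u w (f u).
Proof.
move=> Px0 Pstep.
pose run := foldl (fun s w => (w, step s.1 w s.2)) (r, x0).
have run1 p : (run p).1 = last r p.
  by case/lastP: p => // p z; rewrite /run foldl_rcons last_rcons.
exists (fun w => (run (tree_path e r w)).2); split=> [w|u w ->].
  have /and3P[+ _ _] := tree_pathP r w.
  elim/last_ind: (tree_path e r w) => // p z IHp.
  rewrite rcons_path => /andP[/IHp Pp ez].
  by rewrite /run foldl_rcons -/(run p) /= run1; apply: Pstep.
rewrite [in LHS]/run foldl_rcons -/(run _) /= run1.
by have /and3P[_ _ /eqP ->] := tree_pathP r u.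
Qed.

End TreePaths.

Section NullSupport.

Variables (F : fieldType) (V : finType).
Implicit Type M A : 'M[F]_#|V|.

Lemma null_supportP M w :
  reflect (exists x : 'cV[F]_#|V|, M *m x = 0 /\ x (enum_rank w) 0 <> 0)
    (w \in null_support M).
Proof. by rewrite inE; apply: asboolP. Qed.

Lemma null_support_scale M A (a b : 'I_#|V| -> F) :
  (forall i, a i != 0) -> (forall i, b i != 0) ->
  (forall i j, M i j = a i * A i j * b j) -> null_support M = null_support A.
Proof.
move=> a0 b0 ME.
have mulME x i : (M *m x) i 0 = a i * (A *m \col_j (b j * x j 0)) i 0.
  rewrite !mxE mulr_sumr; apply: eq_bigr => j _.
  by rewrite mxE ME !mulrA.
apply/setP => w; apply/null_supportP/null_supportP => -[x [x0 xw]].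
  exists (\col_j (b j * x j 0)); split.
    apply/colP => i; apply: (mulfI (a0 i)).
    by rewrite -mulME x0 !mxE mulr0.
  by rewrite mxE; apply/eqP; rewrite mulf_neq0 //; apply/eqP.
exists (\col_j ((b j)^-1 * x j 0)); split.
  apply/colP => i; rewrite mulME.
  have -> : \col_j (b j * (\col_k ((b k)^-1 * x k 0)) j 0) = x.
    by apply/colP => j; rewrite !mxE mulVKf.
  by rewrite x0 !mxE mulr0.
by rewrite mxE; apply/eqP; rewrite mulf_neq0 ?invr_eq0 //; apply/eqP.
Qed.

Lemma col_colspace M j : col j M \in colspace M.
Proof. by apply: memv_span; apply/imageP; exists j. Qed.

Lemma mulmx_colspace M y : M *m y \in colspace M.
Proof.
have -> : M *m y = \sum_j y j 0 *: col j M.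
  apply/colP => i; rewrite mxE summxE; apply: eq_bigr => j _.
  by rewrite !mxE mulrC.
by apply: rpred_sum => j _; rewrite rpredZ // col_colspace.
Qed.

Lemma unit_vector_colspace M w : w \notin null_support M^T ->
  delta_mx (enum_rank w) 0 \in colspace M.
Proof.
move=> wN; have : ((delta_mx 0 (enum_rank w) : 'rV[F]_#|V|) <= M^T)%MS.
  rewrite submxE -rowE; apply/eqP/rowP => j; rewrite mxE [RHS]mxE.
  apply/eqP; apply: contraNT wN => ker_wj; apply/null_supportP.
  exists (col j (cokermx M^T)); split; last by rewrite mxE; apply/eqP.
  by rewrite colE mulmxA mulmx_coker mul0mx.
case/submxP => z /(congr1 trmx); rewrite trmx_delta trmx_mul trmxK => ->.
exact: mulmx_colspace.
Qed.

Lemma mem_unit_vectors (U : {vspace 'cV[F]_#|V|}) (S : {set V})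
    (x : 'cV[F]_#|V|) :
  (forall w, w \notin S -> delta_mx (enum_rank w) 0 \in U) ->
  (forall w, w \in S -> x (enum_rank w) 0 = 0) -> x \in U.
Proof.
move=> US xS; rewrite (matrix_sum_delta x); apply: rpred_sum => i _.
rewrite big_ord1 -(enum_valK i).
have [/xS -> | /US ?] := boolP (enum_val i \in S); first by rewrite scale0r mem0v.
exact: rpredZ.
Qed.

Section GraphMatrix.

Variable e : rel V.
Hypothesis e_tree : tree e.

Let e_sym : symmetric e. Proof. by case: e_tree => [[]]. Qed.
Let e_irr : irreflexive e. Proof. by case: e_tree => [[]]. Qed.

Lemma graph_matrix0_neq0 M i j : graph_matrix0 e M ->
  (M i j != 0) = e (enum_val j) (enum_val i).
Proof.
move=> [M0 ME]; have := ME (enum_val j) (enum_val i).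
have := M0 (enum_val j); rewrite /entry !enum_valK.
have [ji|_ _ -> //] := eqVneq (enum_val j) (enum_val i).
by rewrite -(enum_val_inj ji) e_irr => ->; rewrite eqxx.
Qed.

Lemma graph_matrix0_adjacency : graph_matrix0 e (adjacency F e).
Proof.
split=> [u|u w _]; rewrite /entry mxE !enum_rankK; first by rewrite e_irr.
by rewrite e_sym; case: (e u w); rewrite ?oner_eq0 ?eqxx.
Qed.

Lemma graph_matrix0_scale M : graph_matrix0 e M ->
  exists a b : 'I_#|V| -> F, [/\ forall i, a i != 0, forall i, b i != 0 &
    forall i j, M i j = a i * adjacency F e i j * b j].
Proof.
move=> Me; have [_ [/card_gt0P[r _] _] _] := e_tree.
pose step u w (x : F * F) := (entry M u w / x.2, entry M w u / x.1).
pose P (x : F * F) : Prop := (x.1 != 0) && (x.2 != 0).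
have entry0 u w : (entry M u w != 0) = e u w.
  by rewrite /entry graph_matrix0_neq0 // !enum_rankK.
have P1 : P (1, 1) by rewrite /P /= oner_eq0.
have Pstep u w x : e u w -> P x -> P (step u w x).
  move=> euw /andP[x1 x2]; rewrite /P /= !mulf_neq0 ?invr_eq0 ?entry0 //.
  by rewrite e_sym.
have [f [Pf fE]] := tree_recursion e_tree r P1 Pstep.
exists (fun i => (f (enum_val i)).1), (fun j => (f (enum_val j)).2).
split=> [i|i|i j]; [by case/andP: (Pf (enum_val i))..|].
rewrite mxE; have [eij|] := boolP (e _ _); last first.
  rewrite e_sym -(graph_matrix0_neq0 _ _ Me) negbK => /eqP ->.
  by rewrite mulr0 mul0r.
have -> : M i j = entry M (enum_val j) (enum_val i) by rewrite /entry !enum_valK.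
rewrite mulr1; case: (tree_path_edge e_tree r eij) => /fE -> /=.
  have /andP[+ _] := Pf (enum_val i).
  by move=> fi0; rewrite mulrC divfK.
have /andP[_ fj0] := Pf (enum_val j).
by rewrite divfK.
Qed.

Lemma null_support_adjacency M : graph_matrix0 e M ->
  null_support M = null_support (adjacency F e).
Proof.
by move=> /graph_matrix0_scale[a [b [a0 b0]]]; apply: null_support_scale.
Qed.

Lemma null_support_trmx M : graph_matrix0 e M ->
  null_support M^T = null_support M.
Proof.
move=> Me; rewrite (null_support_adjacency Me).
have [a [b [a0 b0 ME]]] := graph_matrix0_scale Me.
apply: (null_support_scale b0 a0) => i j.
by rewrite mxE ME !mxE e_sym mulrC [a j * _]mulrC mulrA.
Qed.

Lemma null_support_nbr M u w : graph_matrix0 e M -> e w u ->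
  u \in null_support M -> w \notin null_support M.
Proof.
move=> Me ewu /null_supportP[x [Mx0 xu]]; rewrite -null_support_trmx //.
apply/negP => /null_supportP[y [My0 yw]].
(* Restricting x to the vertices of T at odd distance from w in the component
   of u in T - w gives a vector that M maps to a nonzero multiple of the unit
   vector of w. *)
pose inS z := odd (size (tree_path e w z)) && (second_vertex e w z == u).
pose x' : 'cV[F]_#|V| := \col_j (if inS (enum_val j) then x j 0 else 0).
have wNS : ~~ inS w by rewrite /inS tree_pathxx.
have uS : inS u.
  by rewrite /inS second_vertex_nbr // eqxx (odd_tree_path_edge e_tree _ ewu) tree_pathxx.
have Mx' i : (M *m x') i 0 =
    if i == enum_rank w then M i (enum_rank u) * x (enum_rank u) 0 else 0.
  rewrite mxE; case: eqP => [->|/eqP iNw].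
    rewrite (bigD1 (enum_rank u)) //= mxE enum_rankK uS big1 ?addr0 // => j jNu.
    rewrite mxE; case: ifP => [/andP[_ sj]|]; last by rewrite mulr0.
    case: (eqVneq (M (enum_rank w) j) 0) => [->|]; first by rewrite mul0r.
    rewrite graph_matrix0_neq0 // enum_rankK e_sym => ewj.
    by rewrite second_vertex_nbr // in sj; rewrite -(eqP sj) enum_valK eqxx in jNu.
  have iw : enum_val i != w.
    by apply: contra iNw => /eqP <-; rewrite enum_valK.
  have edgeS j : M i j != 0 -> enum_val j != w -> inS (enum_val j) =
      ~~ odd (size (tree_path e w (enum_val i))) && (second_vertex e w (enum_val i) == u).
    rewrite graph_matrix0_neq0 // e_sym => eij jw.
    by rewrite /inS (odd_tree_path_edge e_tree w eij) (second_vertex_edge e_tree eij iw jw).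
  case iS: (~~ odd (size (tree_path e w (enum_val i))) &&
            (second_vertex e w (enum_val i) == u)).
    have Mx0i : \sum_j M i j * x j 0 = 0.
      by have := congr1 (fun z : 'cV_ _ => z i 0) Mx0; rewrite !mxE.
    rewrite -[RHS]Mx0i.
    apply: eq_bigr => j _; rewrite mxE.
    have [->|Mij] := eqVneq (M i j) 0; first by rewrite !mul0r.
    rewrite edgeS ?iS //; apply: contraTneq iS => jw.
    move: Mij; rewrite graph_matrix0_neq0 // jw => /(odd_tree_path_edge e_tree w).
    by rewrite tree_pathxx // => ->.
  apply: big1 => j _; rewrite mxE.
  have [->|Mij] := eqVneq (M i j) 0; first by rewrite mul0r.
  have [->|jw] := eqVneq (enum_val j) w; first by rewrite (negPf wNS) mulr0.
  by rewrite edgeS // iS mulr0.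
have : (y^T *m (M *m x')) 0 0 = 0.
  by rewrite mulmxA -[y^T *m M]trmxK trmx_mul trmxK My0 trmx0 mul0mx mxE.
rewrite mxE (bigD1 (enum_rank w)) //= big1 ?addr0 => [|i iw]; last first.
  by rewrite Mx' (negPf iw) mulr0.
rewrite Mx' eqxx mxE; apply/eqP; rewrite !mulf_neq0 //; try exact/eqP.
by rewrite graph_matrix0_neq0 // !enum_rankK e_sym.
Qed.

End GraphMatrix.

Lemma prod_diag_mx (I : Type) (s : seq I) (P : pred I) (d : I -> 'rV[F]_#|V|) :
  \prod_(i <- s | P i) diag_mx (d i) =
  diag_mx (\row_j \prod_(i <- s | P i) d i 0 j).
Proof.
elim: s => [|i s IHs].
  rewrite big_nil; apply/matrixP => j k; rewrite !mxE big_nil.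
  by case: (j == k).
rewrite big_cons; case Pi: (P i); last first.
  by rewrite IHs; congr diag_mx; apply/rowP => j; rewrite !mxE big_cons Pi.
rewrite IHs -[LHS]/(diag_mx (d i) *m _) mulmx_diag; congr diag_mx.
by apply/rowP => j; rewrite !mxE big_cons Pi.
Qed.

End NullSupport.

Theorem lemma12 (F : fieldType) (V : finType) (e : rel V) (M : 'M[F]_#|V|) :
  tree e -> graph_matrix0 e M ->
  (linfun (mulmx (rank_normalization e M)) @: colspace (adjacency F e))%VS
    = colspace M.
Proof.
move=> e_tree Me; have [[e_sym e_irr] _ _] := e_tree.
set A := adjacency F e; set R := rank_normalization e M; set S := null_support M.
have Ae : graph_matrix0 e A by exact: graph_matrix0_adjacency.
have SA : null_support A = S by rewrite /S (null_support_adjacency e_tree Me).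
have entry0 u w : (entry M u w != 0) = e u w.
  by rewrite /entry (graph_matrix0_neq0 e_tree) // !enum_rankK.
pose r w := \prod_(v | v \notin S)
  if w == v then 1 else entry M v (second_vertex e v w).
have r_neq0 w : r w != 0.
  apply/prodf_neq0 => v _; case: (eqVneq w v) => [_|wv]; first exact: oner_neq0.
  by rewrite entry0 second_vertex_adj.
have RE m (B : 'M_(_, m)) w j :
    (R *m B) (enum_rank w) j = r w * B (enum_rank w) j.
  rewrite /R /rank_normalization /normalization prod_diag_mx mul_diag_mx !mxE.
  by congr (_ * _); apply: eq_bigr => v _; rewrite mxE enum_rankK.
pose RA := (linfun (mulmx R) @: colspace A)%VS.
have memRA y : y \in colspace A -> R *m y \in RA.
  by move=> yA; rewrite -[R *m y](lfunE (mulmx R)) memv_img.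
have unitM w : w \notin S -> delta_mx (enum_rank w) 0 \in colspace M.
  by move=> wS; apply: unit_vector_colspace; rewrite (null_support_trmx e_tree).
have unitRA w : w \notin S -> delta_mx (enum_rank w) 0 \in RA.
  rewrite -SA -(null_support_trmx e_tree) // => /unit_vector_colspace wA.
  have -> : delta_mx (enum_rank w) 0 =
      R *m ((r w)^-1 *: delta_mx (enum_rank w) 0) :> 'cV_#|V|.
    apply/colP => i; rewrite -(enum_valK i) RE !mxE.
    rewrite (can_eq enum_rankK) andbT.
    case: (eqVneq (enum_val i) w) => [->|_]; last by rewrite !mulr0.
    by rewrite mulr1 divff.
  by rewrite memRA // rpredZ.
have col_in u : u \in S -> forall N, graph_matrix0 e N ->
    forall w, w \in S -> N (enum_rank w) (enum_rank u) = 0.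
  move=> uS N Ne w wS; apply: contraTeq wS.
  rewrite (graph_matrix0_neq0 e_tree) // !enum_rankK e_sym => ewu.
  exact: (null_support_nbr e_tree Me ewu).
pose c u := \prod_(v | (v \notin S) && (v != u)) entry M v (second_vertex e v u).
have c_neq0 u : c u != 0.
  by apply/prodf_neq0 => v /andP[_ vu]; rewrite entry0 second_vertex_adj // eq_sym.
have col_out u w : u \notin S -> w \in S ->
    (R *m col (enum_rank u) A) (enum_rank w) 0 =
    c u * col (enum_rank u) M (enum_rank w) 0.
  move=> uS wS; rewrite RE !mxE !enum_rankK.
  have [ewu|] := boolP (e w u); last first.
    by rewrite mulr0 e_sym -entry0 negbK /entry => /eqP ->; rewrite mulr0.
  have wu : w != u by apply: contraNneq uS => <-.
  have euw : e u w by rewrite e_sym.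
  rewrite mulr1 /r (bigD1 u) //= (negPf wu) second_vertex_nbr // mulrC.
  congr (_ * _); apply: eq_bigr => v /andP[vS vu].
  have wv : w != v by apply: contraNneq vS => <-.
  by rewrite (negPf wv) (second_vertex_edge e_tree euw) // eq_sym.
apply/eqP; rewrite eqEsubv; apply/andP; split.
  rewrite limg_span; apply/span_subvP => _ /mapP[_ /mapP[j _ ->] ->].
  rewrite lfunE /= -(enum_valK j); set u := enum_val j.
  have [uS|uS] := boolP (u \in S).
    by apply: (mem_unit_vectors unitM) => w wS; rewrite RE mxE col_in ?mulr0.
  rewrite -[R *m _](subrK (c u *: col (enum_rank u) M)) rpredD //.
    apply: (mem_unit_vectors unitM) => w wS.
    by rewrite mxE col_out // !mxE subrr.
  by rewrite rpredZ // col_colspace.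
apply/span_subvP => _ /mapP[j _ ->]; rewrite -(enum_valK j); set u := enum_val j.
have [uS|uS] := boolP (u \in S).
  by apply: (mem_unit_vectors unitRA) => w wS; rewrite mxE col_in.
rewrite -[col _ M](subrK (R *m ((c u)^-1 *: col (enum_rank u) A))) rpredD //.
  apply: (mem_unit_vectors unitRA) => w wS.
  by rewrite -scalemxAr mxE [X in _ + X]mxE [X in - X]mxE col_out // mulKf ?subrr.
by rewrite memRA // rpredZ // col_colspace.
Qed.
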